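(* Let $H$ and $A$ be finitely generated abelian groups such that there is an epimorphism $H\twoheadrightarrow A$. Set $n=\operatorname{rank}H$, $r=\operatorname{rank}A$. There is a bijection $$\Gamma(H,A)\ \longleftrightarrow\ \mathrm{GL}_n(\mathbb{Z})\times_{\mathrm{P}}\Gamma$$ between the parameter set $\Gamma(H,A)=\operatorname{Epi}(H,A)/\operatorname{Aut}(A)$ and the twisted product of $\mathrm{GL}_n(\mathbb{Z})$ with the set $\Gamma=\Gamma(H/\overline{A},A/\overline{A})$ over the parabolic subgroup $\mathrm{P}$. Under this bijection, the map $q\colon\Gamma(H,A)\to\Gamma(H,\overline{A})$ induced by the projection $\pi\colon A\to\overline{A}$ corresponds to the canonical projection $$\mathrm{GL}_n(\mathbb{Z})\times_{\mathrm{P}}\Gamma\to\mathrm{GL}_n(\mathbb{Z})/\mathrm{P}=\mathrm{Gr}_{n-r}(\mathbb{Z}^n).$$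
   Context: For finitely generated abelian groups $K,B$, $\operatorname{Epi}(K,B)$ is the set of epimorphisms $K\twoheadrightarrow B$ and $\Gamma(K,B)=\operatorname{Epi}(K,B)/\operatorname{Aut}(B)$, where $\operatorname{Aut}(B)$ acts by composition. $\overline{H}=H/\operatorname{Tors}(H)$ and $\overline{A}=A/\operatorname{Tors}(A)$; identify $\overline{H}=\mathbb{Z}^n$, $\overline{A}=\mathbb{Z}^r$, and fix splittings $\overline{H}\hookrightarrow H$, $\overline{A}\hookrightarrow A$. Choosing also a splitting $\overline{A}\hookrightarrow H$ (with image in $\overline{H}$) of an epimorphism $H\twoheadrightarrow\overline{A}$, one has $H/\overline{A}\cong \mathbb{Z}^{n-r}\oplus\operatorname{Tors}(H)$ and $A/\overline{A}\cong\operatorname{Tors}(A)$. So an element of $\Gamma=\Gamma(H/\overline{A},A/\overline{A})$ is a class $[\gamma_1,\gamma_2]$ of epimorphisms $(\gamma_1,\gamma_2)\colon \mathbb{Z}^{n-r}\oplus\operatorname{Tors}(H)\twoheadrightarrow\operatorname{Tors}(A)$ modulo $\operatorname{Aut}(\operatorname{Tors}(A))$. The map $q$ sends $[\nu]$ to $[\pi\circ\nu]$. $\mathrm{Gr}_{n-r}(\mathbb{Z}^n)$ is the set of primitive (direct summand) subgroups of rank $n-r$ of $\mathbb{Z}^n$. It is identified with $\Gamma(H,\overline{A})$ by sending $[\mu]$ to the kernel of the map $\overline{H}=\mathbb{Z}^n\to\overline{A}$ induced by $\mu$. $\mathrm{P}$ is the group of matrices $Q=\begin{pmatrix} Q_1&Q_2\\0&Q_3\end{pmatrix}\in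 \mathrm{GL}_n(\mathbb{Z})$ with $Q_1$ of size $(n-r)\times(n-r)$, and $\mathrm{GL}_n(\mathbb{Z})/\mathrm{P}=\mathrm{Gr}_{n-r}(\mathbb{Z}^n)$ by sending $M$ to the span of its first $n-r$ columns. $\mathrm{P}$ acts on $\mathrm{GL}_n(\mathbb{Z})$ by right multiplication and on $\Gamma$ by $Q\cdot[\gamma_1,\gamma_2]=[\gamma_1Q_1^{-1},\gamma_2]$. The twisted product $\mathrm{GL}_n(\mathbb{Z})\times_{\mathrm{P}}\Gamma$ is the quotient of $\mathrm{GL}_n(\mathbb{Z})\times\Gamma$ by the relation $(MQ,\gamma)\sim(M,Q\cdot\gamma)$, $Q\in \mathrm{P}$; the canonical projection sends the class of $(M,\gamma)$ to $M\mathrm{P}$. *)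

(* Defs.v *)
From HB Require Import structures.
From mathcomp Require Import all_boot all_order all_algebra.
From mathcomp Require Import boolp classical_sets functions.

Set Implicit Arguments.
Unset Strict Implicit.
Unset Printing Implicit Defensive.

Import GRing.Theory.
Local Open Scope ring_scope.
Local Open Scope quotient_scope.

Definition fin_gen (K : zmodType) : Prop :=
  exists s : seq K, forall x : K,
    exists c : 'I_(size s) -> int, x = \sum_(i < size s) s`_i *~ c i.

Definition zindep (K : zmodType) (m : nat) (x : 'I_m -> K) : Prop :=
  forall c : 'I_m -> int, \sum_(i < m) x i *~ c i = 0 -> forall i, c i = 0.

(* Maximal size of a Z-independent family of elements of [S]; applied to the
   whole group and to subgroups. *)
Definition has_rank (K : zmodType) (S : set K) (k : nat) : Prop :=
  (exists2 x : 'I_k -> K, (forall i, S (x i)) & zindep x) /\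
  (forall m (x : 'I_m -> K), (forall i, S (x i)) -> zindep x -> (m <= k)%N).

Definition torsion (K : zmodType) : {pred K} :=
  fun x => `[< exists2 m : nat, (0 < m)%N & x *+ m = 0 >].
Arguments torsion : clear implicits.

Lemma torsion_zmod_closed (K : zmodType) : zmod_closed (torsion K).
Proof.
split; first by apply/asboolP; exists 1%N.
move=> x y /asboolP[m m0 xm] /asboolP[p p0 yp]; apply/asboolP.
exists (m * p)%N; first by rewrite muln_gt0 m0.
by rewrite mulrnBl mulrnA xm mul0rn mulnC mulrnA yp mul0rn subrr.
Qed.

HB.instance Definition _ (K : zmodType) :=
  GRing.isZmodClosed.Build K (torsion K) (torsion_zmod_closed K).

Definition Tors (K : zmodType) : Type := {x : K | x \in torsion K}.
HB.instance Definition _ (K : zmodType) := SubChoice.on (Tors K).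
HB.instance Definition _ (K : zmodType) :=
  [SubChoice_isSubZmodule of Tors K by <:].

Notation bar K := (Quotient.quot (torsion K)).

Lemma bar_eqP (K : zmodType) (x y : K) :
  reflect (\pi_(bar K) x = \pi_(bar K) y) (x - y \in torsion K).
Proof. by rewrite Quotient.idealrBE; exact: eqP. Qed.

Lemma bar_torsion_free (K : zmodType) (x : bar K) : x \in torsion (bar K) -> x = 0.
Proof.
move=> /asboolP[m m0]; rewrite -[x]reprK -raddfMn -[RHS](raddf0 \pi_(bar K)).
move=> /bar_eqP; rewrite subr0 => /asboolP[p p0 xp].
rewrite -[RHS](raddf0 \pi_(bar K)); apply/bar_eqP; rewrite subr0; apply/asboolP.
by exists (m * p)%N; rewrite ?muln_gt0 ?m0 // mulrnA.
Qed.

Record epi (K B : zmodType) := Epi {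
  epi_fun :> {additive K -> B};
  epi_surj : forall y, exists x, epi_fun x = y
}.

HB.instance Definition _ K B := gen_eqMixin (epi K B).
HB.instance Definition _ K B := gen_choiceMixin (epi K B).

Section Gamma.
Variables K B : zmodType.

Definition aut_rel (f g : epi K B) : bool :=
  `[< exists2 a : {additive B -> B}, bijective a & forall x, g x = a (f x) >].

Lemma aut_rel_refl : reflexive aut_rel.
Proof. by move=> f; apply/asboolP; exists idfun; first by exists id. Qed.

Lemma aut_rel_sym_imp f g : aut_rel f g -> aut_rel g f.
Proof.
move=> /asboolP[a [b ab ba] fg]; apply/asboolP.
pose b' : {additive B -> B} := HB.pack b
  (GRing.isZmodMorphism.Build B B b (can2_zmod_morphism ab ba)).
by exists b' => [|x /=]; [exists a | rewrite fg ab].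
Qed.

Lemma aut_rel_sym : symmetric aut_rel.
Proof. by move=> f g; apply/idP/idP; exact: aut_rel_sym_imp. Qed.

Lemma aut_rel_trans : transitive aut_rel.
Proof.
move=> g f h /asboolP[a ba fg] /asboolP[b bb gh]; apply/asboolP.
by exists (b \o a) => [|x /=]; [exact: bij_comp | rewrite gh fg].
Qed.

Canonical aut_equiv := EquivRel aut_rel aut_rel_refl aut_rel_sym aut_rel_trans.

Definition Gamma := {eq_quot aut_rel}.
HB.instance Definition _ := Choice.on Gamma.
HB.instance Definition _ : EqQuotient _ aut_rel Gamma := EqQuotient.on Gamma.

Lemma GammaP (f g : epi K B) : reflect
  (exists2 a : {additive B -> B}, bijective a & forall x, g x = a (f x))
  (\pi_Gamma f == \pi_Gamma g).
Proof. by rewrite piE; exact: asboolP. Qed.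

End Gamma.

Section Projection.
Variables H A : zmodType.

Lemma proj_epi_surj (f : epi H A) (y : bar A) : exists x, (\pi_(bar A) \o f) x = y.
Proof. by have [x fx] := epi_surj f (repr y); exists x; rewrite /= fx reprK. Qed.

Definition proj_epi (f : epi H A) : epi H (bar A) := Epi (proj_epi_surj f).

Definition q : Gamma H A -> Gamma H (bar A) :=
  lift_op11 (Gamma H A) (Gamma H (bar A)) proj_epi.

Lemma pi_q (f : epi H A) :
  \pi_(Gamma H (bar A)) (proj_epi f) = q (\pi_(Gamma H A) f).
Proof.
rewrite /q -lock; apply/eqP/GammaP.
have /esym/eqP/GammaP[a [b ab ba] fa] := reprK (\pi_(Gamma H A) f).
have aT x : (a x \in torsion A) = (x \in torsion A).
  apply/asboolP/asboolP=> -[m m0 xm]; exists m => //; last by rewrite -raddfMn xm raddf0.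
  by apply: (can_inj ab); rewrite raddfMn xm raddf0.
pose c (x : bar A) : bar A := \pi_(bar A) (a (repr x)).
have cE x : c (\pi_(bar A) x) = \pi_(bar A) (a x).
  by apply/bar_eqP; rewrite -raddfB aT; apply/bar_eqP; rewrite reprK.
have cB : zmod_morphism c.
  move=> x y; rewrite -[x]reprK -[y]reprK -raddfB !cE.
  by rewrite raddfB raddfB.
pose c' : {additive bar A -> bar A} := HB.pack c
  (GRing.isZmodMorphism.Build _ _ c cB).
exists c' => [|x /=]; last by rewrite cE fa.
have dE x : \pi_(bar A) (b (repr (\pi_(bar A) x))) = \pi_(bar A) (b x).
  by apply/bar_eqP; rewrite -aT raddfB !ba; apply/bar_eqP; rewrite reprK.
exists (fun x => \pi_(bar A) (b (repr x))) => x /=.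
  by rewrite -[x]reprK cE dE ab.
by rewrite -[x]reprK dE cE ba.
Qed.
Canonical pi_q_morph := PiMorph11 pi_q.

(* Independent of the representative, since [bar A] is torsion-free:
   see [inducedE]. *)
Definition induced (mu : epi H (bar A)) (x : bar H) : bar A := mu (repr x).

Lemma inducedE (mu : epi H (bar A)) (x : H) : induced mu (\pi_(bar H) x) = mu x.
Proof.
apply/eqP; rewrite -subr_eq0 -raddfB; apply/eqP/bar_torsion_free.
have /bar_eqP/asboolP[m m0 xm] := reprK (\pi_(bar H) x).
by apply/asboolP; exists m => //; rewrite -raddfMn xm raddf0.
Qed.

Variables (n : nat) (iH : {additive 'cV[int]_n -> bar H}).

(* [iH] is an identification Z^n = bar H when it is bijective. *)
Definition ker_induced (mu : epi H (bar A)) : set 'cV[int]_n :=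
  [set v | induced mu (iH v) = 0]%classic.

Definition kappa : Gamma H (bar A) -> set 'cV[int]_n :=
  lift_fun1 (Gamma H (bar A)) ker_induced.

Lemma pi_kappa (mu : epi H (bar A)) : kappa (\pi_(Gamma H (bar A)) mu) = ker_induced mu.
Proof.
rewrite /kappa -lock.
have /esym/eqP/GammaP[a ba fa] := reprK (\pi_(Gamma H (bar A)) mu).
apply/seteqP; split=> v; rewrite /ker_induced /= /induced fa.
  by move=> av0; apply: (bij_inj ba); rewrite raddf0.
by move=> ->; rewrite raddf0.
Qed.

End Projection.

Definition is_subgroup (V : zmodType) (L : set V) : Prop :=
  L 0 /\ forall x y, L x -> L y -> L (x - y).

Definition direct_summand (V : zmodType) (L : set V) : Prop :=
  is_subgroup L /\
  exists C : set V, [/\ is_subgroup C,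
    forall x, L x -> C x -> x = 0 &
    forall x, exists y z, [/\ L y, C z & x = y + z]].

Definition Gr (k n : nat) : set (set 'cV[int]_n) :=
  [set L | direct_summand L /\ has_rank L k]%classic.
Arguments Gr : clear implicits.

Definition GL (n : nat) : Type := {M : 'M[int]_n | M \in unitmx}.
HB.instance Definition _ n := SubChoice.on (GL n).

Record parabolic (n r : nat) := Parabolic {
  par_mx :> 'M[int]_n;
  par_unit : par_mx \in unitmx;
  par_low0 : forall i j : 'I_n, (j < n - r <= i)%N -> par_mx i j = 0
}.

Definition first_idx (n r : nat) : 'I_(n - r) -> 'I_n :=
  widen_ord (leq_subr r n).

Definition Q1 (n r : nat) (Q : parabolic n r) : 'M[int]_(n - r) :=
  mxsub (@first_idx n r) (@first_idx n r) Q.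

Lemma low0_block n k (hk : (k <= n)%N) (Q : 'M[int]_n) :
  Q \in unitmx -> (forall i j : 'I_n, (j < k <= i)%N -> Q i j = 0) ->
  mxsub (widen_ord hk) (widen_ord hk) Q \in unitmx /\
  forall i j : 'I_n, (j < k <= i)%N -> invmx Q i j = 0.
Proof.
have [l nE] : exists l, n = (k + l)%N by exists (n - k)%N; rewrite subnKC.
subst n => uQ Q0.
have Qdl : dlsubmx Q = 0.
  by apply/matrixP=> i j; rewrite !mxE Q0 //= ltn_ord leq_addr.
have QE : Q = block_mx (ulsubmx Q) (ursubmx Q) 0 (drsubmx Q).
  by rewrite -Qdl submxK.
have /andP[u1 u3] : (ulsubmx Q \in unitmx) && (drsubmx Q \in unitmx).
  by move: uQ; rewrite QE !unitmxE det_ublock unitrM -QE.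
have -> : mxsub (widen_ord hk) (widen_ord hk) Q = ulsubmx Q.
  by apply/matrixP=> i j; rewrite !mxE; congr (Q _ _); apply: val_inj.
split=> // i j /andP[jk ki].
have I0 : dlsubmx (invmx Q) = 0.
  have : dlsubmx (Q *m invmx Q) = 0.
    by rewrite mulmxV // scalar_mx_block block_mxKdl.
  rewrite {1}QE -{1}(submxK (invmx Q)) mulmx_block block_mxKdl mul0mx add0r.
  by move=> /(congr1 (mulmx (invmx (drsubmx Q)))); rewrite mulKmx // mulmx0.
have jE : j = lshift l (Ordinal jk) by apply: val_inj.
have hi : (i - k < l)%N by rewrite ltn_subLR.
have iE' : i = rshift k (Ordinal hi) by apply: val_inj; rewrite /= subnKC.
by move/matrixP/(_ (Ordinal hi) (Ordinal jk)): I0; rewrite !mxE -iE' -jE.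
Qed.

Section ParabolicGroup.
Variables n r : nat.

Lemma Q1_unit (Q : parabolic n r) : Q1 Q \in unitmx.
Proof. by have [] := low0_block (leq_subr r n) (par_unit Q) (@par_low0 _ _ Q). Qed.

Lemma par_one_low0 (i j : 'I_n) : (j < n - r <= i)%N -> 1%:M i j = 0 :> int.
Proof.
move=> /andP[jk ki]; rewrite mxE; case: eqP => // ij.
by move: (leq_trans jk ki); rewrite ij ltnn.
Qed.

Definition par_one : parabolic n r := Parabolic (unitmx1 _ n) par_one_low0.

Definition par_inv (Q : parabolic n r) : parabolic n r.
Proof.
exists (invmx Q); first by rewrite unitmx_inv; exact: par_unit.
by have [] := low0_block (leq_subr r n) (par_unit Q) (@par_low0 _ _ Q).
Defined.

Definition par_mul (Q R : parabolic n r) : parabolic n r.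
Proof.
exists (Q *m R); first by rewrite unitmx_mul !par_unit.
move=> i j /andP[jk ki]; rewrite mxE big1 // => l _.
have [lk|kl] := ltnP l (n - r); first by rewrite par_low0 ?mul0r // lk.
by rewrite (@par_low0 _ _ R) ?mulr0 // jk.
Defined.

Lemma Q1_one : Q1 par_one = 1%:M.
Proof. by apply/matrixP=> i j; rewrite !mxE. Qed.

Lemma colsub_par p (M : 'M[int]_(p, n)) (Q : parabolic n r) :
  colsub (@first_idx n r) (M *m Q) = colsub (@first_idx n r) M *m Q1 Q.
Proof.
apply/matrixP=> i j; rewrite !mxE.
rewrite (bigID (fun l : 'I_n => (l < n - r)%N)) /= [X in _ + X]big1 ?addr0.
  rewrite (big_ord_narrow (leq_subr r n)) /=.
  by apply: eq_bigr => l _; rewrite !mxE.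
by move=> l; rewrite -leqNgt => kl; rewrite (@par_low0 _ _ Q) ?mulr0 //= ltn_ord.
Qed.

Lemma Q1_mul (Q R : parabolic n r) : Q1 (par_mul Q R) = Q1 Q *m Q1 R.
Proof.
have -> : Q1 (par_mul Q R) = rowsub (@first_idx n r) (colsub (@first_idx n r) (Q *m R)).
  by apply/matrixP=> i j; rewrite !mxE.
rewrite colsub_par -mul_rowsub_mx; congr (_ *m _).
by apply/matrixP=> i j; rewrite !mxE.
Qed.

Lemma Q1_inv (Q : parabolic n r) : Q1 (par_inv Q) = invmx (Q1 Q).
Proof.
have : Q1 Q *m Q1 (par_inv Q) = 1%:M.
  rewrite -Q1_mul -Q1_one /Q1 /= mulmxV ?par_unit //.
by move=> /(congr1 (mulmx (invmx (Q1 Q)))); rewrite mulKmx ?Q1_unit // mulmx1.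
Qed.

Definition coset_rel (M N : GL n) : bool :=
  `[< exists Q : parabolic n r, val M = val N *m Q >].

Lemma coset_rel_refl : reflexive coset_rel.
Proof. by move=> M; apply/asboolP; exists par_one; rewrite mulmx1. Qed.

Lemma coset_rel_sym : symmetric coset_rel.
Proof.
suff imp M N : coset_rel M N -> coset_rel N M by move=> M N; apply/idP/idP; exact: imp.
move=> /asboolP[Q MN]; apply/asboolP; exists (par_inv Q).
by rewrite MN mulmxK ?par_unit.
Qed.

Lemma coset_rel_trans : transitive coset_rel.
Proof.
move=> N M L /asboolP[Q MN] /asboolP[R NL]; apply/asboolP.
by exists (par_mul R Q); rewrite MN NL mulmxA.
Qed.

Canonical coset_equiv := EquivRel coset_rel coset_rel_refl coset_rel_sym coset_rel_trans.

Definition GLmodP := {eq_quot coset_rel}.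
HB.instance Definition _ := Choice.on GLmodP.
HB.instance Definition _ : EqQuotient _ coset_rel GLmodP := EqQuotient.on GLmodP.

Definition first_cols_span (M : GL n) : set 'cV[int]_n :=
  [set v | exists c : 'cV[int]_(n - r), v = colsub (@first_idx n r) (val M) *m c]%classic.

Definition sigma : GLmodP -> set 'cV[int]_n := lift_fun1 GLmodP first_cols_span.

Lemma pi_sigma (M : GL n) : sigma (\pi_GLmodP M) = first_cols_span M.
Proof.
rewrite /sigma -lock; set N := repr _.
have /eqP : \pi_GLmodP N = \pi_GLmodP M by rewrite reprK.
rewrite piE => /asboolP[Q NM].
apply/seteqP; rewrite /first_cols_span NM colsub_par; split=> v /= [c ->].
  by exists (Q1 Q *m c); rewrite mulmxA.
by exists (invmx (Q1 Q) *m c); rewrite -mulmxA mulKVmx ?Q1_unit.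
Qed.

End ParabolicGroup.

Section TwistedProduct.
Variables (H A : zmodType) (n r : nat).

(* Gamma(H/bar A, A/bar A), through the splittings
   H/bar A = Z^(n-r) (+) Tors H and A/bar A = Tors A. *)
Definition GammaT := Gamma ('cV[int]_(n - r) * Tors H)%type (Tors A).

Definition block_act (Q : parabolic n r) (x : 'cV[int]_(n - r) * Tors H) :
  'cV[int]_(n - r) * Tors H := (invmx (Q1 Q) *m x.1, x.2).

Lemma block_act_zmod_morphism Q : zmod_morphism (block_act Q).
Proof. by move=> x y; rewrite /block_act mulmxBr. Qed.

HB.instance Definition _ Q :=
  GRing.isZmodMorphism.Build _ _ (block_act Q) (block_act_zmod_morphism Q).

Lemma act_epi_surj (Q : parabolic n r)
    (g : epi ('cV[int]_(n - r) * Tors H)%type (Tors A)) (y : Tors A) :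
  exists x, (g \o block_act Q) x = y.
Proof.
have [[v t] <-] := epi_surj g y; exists (Q1 Q *m v, t).
by rewrite /= /block_act /= mulKmx ?Q1_unit.
Qed.

(* [gamma_1, gamma_2] |-> [gamma_1 Q1^-1, gamma_2] *)
Definition act_epi (Q : parabolic n r)
    (g : epi ('cV[int]_(n - r) * Tors H)%type (Tors A)) :
  epi ('cV[int]_(n - r) * Tors H)%type (Tors A) := Epi (act_epi_surj Q g).

Definition act (Q : parabolic n r) : GammaT -> GammaT :=
  lift_op1 GammaT (act_epi Q).

Lemma pi_act Q g : \pi_GammaT (act_epi Q g) = act Q (\pi_GammaT g).
Proof.
rewrite /act -lock; apply/eqP/GammaP.
have /esym/eqP/GammaP[a ba ga] := reprK (\pi_GammaT g).
by exists a => //= x; rewrite ga.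
Qed.

Lemma act_one x : act (par_one n r) x = x.
Proof.
rewrite -[x]reprK -pi_act; apply/eqP/GammaP; exists idfun; first by exists id.
by case=> v t /=; rewrite /block_act Q1_one invmx1 mul1mx.
Qed.

Lemma act_mul Q R x : act (par_mul Q R) x = act Q (act R x).
Proof.
rewrite -[x]reprK -!pi_act; apply/eqP/GammaP; exists idfun; first by exists id.
case=> v t /=; rewrite /block_act /= Q1_mul; congr (repr x (_, _)).
rewrite mulmxA; congr (_ *m _).
have u : Q1 Q *m Q1 R \in unitmx by rewrite unitmx_mul !Q1_unit.
apply: (can_inj (mulKmx u)); rewrite mulmxV // -mulmxA.
by rewrite (mulmxA (Q1 R)) mulmxV ?Q1_unit // mul1mx mulmxV ?Q1_unit.
Qed.

Lemma act_inv Q x : act (par_inv Q) (act Q x) = x.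
Proof.
rewrite -act_mul -[RHS]act_one -[x]reprK -!pi_act; apply/eqP/GammaP.
exists idfun; first by exists id.
by case=> v t /=; rewrite /block_act Q1_mul Q1_inv mulVmx ?Q1_unit // Q1_one.
Qed.

(* (M Q, gamma) ~ (M, Q . gamma) *)
Definition twist_rel (x y : GL n * GammaT) : bool :=
  `[< exists2 Q : parabolic n r, val x.1 = val y.1 *m Q & y.2 = act Q x.2 >].

Lemma twist_rel_refl : reflexive twist_rel.
Proof.
by move=> x; apply/asboolP; exists (par_one n r); rewrite ?mulmx1 ?act_one.
Qed.

Lemma twist_rel_sym : symmetric twist_rel.
Proof.
suff imp x y : twist_rel x y -> twist_rel y x by move=> x y; apply/idP/idP; exact: imp.
move=> /asboolP[Q xy1 xy2]; apply/asboolP.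
exists (par_inv Q); last by rewrite xy2 act_inv.
by rewrite xy1 mulmxK ?par_unit.
Qed.

Lemma twist_rel_trans : transitive twist_rel.
Proof.
move=> y x z /asboolP[Q xy1 xy2] /asboolP[R yz1 yz2]; apply/asboolP.
exists (par_mul R Q); first by rewrite xy1 yz1 mulmxA.
by rewrite act_mul -xy2.
Qed.

Canonical twist_equiv := EquivRel twist_rel twist_rel_refl twist_rel_sym twist_rel_trans.

Definition twisted_product := {eq_quot twist_rel}.
HB.instance Definition _ := Choice.on twisted_product.
HB.instance Definition _ : EqQuotient _ twist_rel twisted_product :=
  EqQuotient.on twisted_product.

Definition canonical_proj : twisted_product -> GLmodP n r :=
  lift_op11 twisted_product (GLmodP n r) fst.

Lemma pi_canonical_proj (x : GL n * GammaT) :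
  \pi_(GLmodP n r) x.1 = canonical_proj (\pi_twisted_product x).
Proof.
rewrite /canonical_proj -lock; set y := repr _.
have /eqP : \pi_twisted_product x = \pi_twisted_product y by rewrite reprK.
rewrite piE => /asboolP[Q xy _]; apply/eqP; rewrite piE; apply/asboolP.
by exists Q.
Qed.

End TwistedProduct.

(* Main.v *)
Require Import Defs.
From HB Require Import structures.
From mathcomp Require Import all_boot all_order all_algebra.
From mathcomp Require Import boolp classical_sets functions.

Set Implicit Arguments.
Unset Strict Implicit.
Unset Printing Implicit Defensive.

Import GRing.Theory.

Local Open Scope classical_set_scope.

(** Two epimorphisms [H -> A] differ by an automorphism of [A] exactly when they
    have the same kernel ([Gamma_kerP]), so every class in sight is a kernel,
    and the theorem describes the kernels of the epimorphisms onto [A].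

    Fix a splitting of [H] into [Z^n] and [Tors H] ([splitting_exists]).  An
    epimorphism [f : H -> A] yields two data.  The vectors [v] in [Z^n] that [f]
    sends into [Tors A] form the kernel of the surjection from [Z^n] to [bar A],
    hence a primitive subgroup of rank [n - r], spanned by the first [n - r]
    columns of some [M] in [GL_n(Z)].  On this subgroup plus [Tors H], the map [f]
    restricts to an epimorphism [g] onto [Tors A], read in the coordinates given
    by those columns.  The relation [matches f M g] records this.  Every [f]
    matches some pair ([matches_exists_pair]), because all of the preimage of
    [Tors A] lies in the domain of [g].  Every pair is matched by some [f]
    ([matches_exists_epi]): extend [g] by a map on the span of the remaining
    columns which lifts a basis of [bar A].  Finally [ker f] is contained in the
    domain of [g] and equals [ker g], so it determines and is determined by the
    primitive subgroup and [ker g]; the matrix [M] is determined by the subgroup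
    up to right multiplication by [P], and changing [M] changes [g] by the action
    of [P].  That is [matches_eqP], and with the two existence statements it makes
    [f |-> (M, g)] a bijection onto the twisted product.  The first component of
    a matching pair is by definition a basis of the kernel which [q] attaches to [f]; this
    gives the compatibility with the two projections.

    The lattice input is that a saturated subgroup of rank [k] of [Z^n] is
    spanned by the first [k] columns of an invertible matrix
    ([saturated_basis], from the Smith normal form).  Direct summands and kernels
    of maps to torsion-free groups are both saturated, so this one fact shows
    that [sigma] is onto the Grassmannian and that kernels lie in it; a rank count
    ([ker_span]) shows that the latter have rank [n - r]. *)

(** * Classes of epimorphisms as kernels *)

Section Epimorphisms.
Local Open Scope ring_scope.
Local Open Scope quotient_scope.

(** If the kernels agree then so do the fibres, and [f x |-> g x] is a well-defined
    automorphism of [B]. *)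
Lemma Gamma_kerP (K B : zmodType) (f g : epi K B) :
  \pi_(Gamma K B) f = \pi_(Gamma K B) g <-> (forall x, f x = 0 <-> g x = 0).
Proof.
split=> [/eqP/GammaP[a ba fa] x | kfg].
  rewrite fa; split=> [-> | ax]; first by rewrite raddf0.
  by apply: (bij_inj ba); rewrite ax raddf0.
have fib x y : f x = f y <-> g x = g y.
  split=> /eqP; rewrite -subr_eq0 -raddfB => /eqP/kfg/eqP;
    by rewrite raddfB subr_eq0 => /eqP.
have [lf lfK] := choice (epi_surj f); have [lg lgK] := choice (epi_surj g).
pose a y := g (lf y).
have aE x : a (f x) = g x by apply/fib; rewrite lfK.
have aB : zmod_morphism a.
  by move=> y z; rewrite -[y]lfK -[z]lfK -raddfB !aE raddfB.
pose a' : {additive B -> B} := HB.pack a (GRing.isZmodMorphism.Build B B a aB).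
apply/eqP/GammaP; exists a' => [|x]; last by rewrite /= aE.
exists (fun y => f (lg y)) => y /=; last by rewrite aE lgK.
by rewrite -[y in RHS]lfK; apply/fib; rewrite lgK.
Qed.

End Epimorphisms.

(** * Subgroups of Z^n and bases *)

Section Lattices.
Local Open Scope ring_scope.

(** Equivalently, the quotient by [L] is torsion-free. *)
Definition saturated (V : zmodType) (L : set V) : Prop :=
  is_subgroup L /\ forall (c : int) x, c != 0 -> L (x *~ c) -> L x.

Section Subgroup.
Variables (V : zmodType) (L : set V).
Hypothesis sL : is_subgroup L.

Lemma subgroupN x : L x -> L (- x).
Proof. by move=> Lx; rewrite -sub0r; apply: sL.2 => //; exact: sL.1. Qed.

Lemma subgroupD x y : L x -> L y -> L (x + y).
Proof. by move=> Lx Ly; rewrite -[y]opprK; apply: sL.2 => //; exact: subgroupN. Qed.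

Lemma subgroupMz x c : L x -> L (x *~ c).
Proof.
move=> Lx; have Ln (m : nat) : L (x *+ m).
  by elim: m => [|m IH]; [exact: sL.1 | rewrite mulrS; exact: subgroupD].
by case: c => m; [exact: Ln | apply/subgroupN/Ln].
Qed.

Lemma subgroup_sum (I : Type) (s : seq I) (F : I -> V) :
  (forall i, L (F i)) -> L (\sum_(i <- s) F i).
Proof.
by move=> LF; apply: big_ind => //; [exact: sL.1 | exact: subgroupD].
Qed.
End Subgroup.

Lemma mulrz_mx m n (A : 'M[int]_(m, n)) (c : int) : A *~ c = c *: A.
Proof. by rewrite -scaler_int intz. Qed.

Lemma cV_mulrz_eq0 n (v : 'cV[int]_n) (c : int) : c != 0 -> v *~ c = 0 -> v = 0.
Proof.
move=> c0 /eqP; rewrite mulrz_mx scalemx_eq0 (negPf c0) => /eqP //.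
Qed.

(** If [x = y + z] and a multiple of [x] lies in [L], then the same multiple of [z]
    lies in both summands, hence vanishes. *)
Lemma direct_summand_saturated n (L : set 'cV[int]_n) :
  direct_summand L -> saturated L.
Proof.
move=> [sL [C [sC LC0 LC]]]; split=> // c x c0 Lxc.
have [y [z [Ly Cz xE]]] := LC x.
suff z0 : z = 0 by rewrite xE z0 addr0.
apply: (cV_mulrz_eq0 c0); apply: LC0; last exact: (subgroupMz sC).
have -> : z *~ c = x *~ c - y *~ c by rewrite xE mulrzDl addrC addKr.
by apply: sL.2 => //; exact: subgroupMz.
Qed.

Definition family_cat (V : Type) k l (x : 'I_k -> V) (y : 'I_l -> V) (i : 'I_(k + l)) :=
  match fintype.split i with inl j => x j | inr j => y j end.

Lemma family_catP (V : Type) k l (x : 'I_k -> V) (y : 'I_l -> V) (P : V -> Prop) :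
  (forall j, P (x j)) -> (forall j, P (y j)) -> forall i, P (family_cat x y i).
Proof. by move=> Px Py i; rewrite /family_cat; case: fintype.split. Qed.

(** The hypothesis on [y] says that [y] stays independent modulo the span of [x]. *)
Lemma zindep_cat (V : zmodType) k l (x : 'I_k -> V) (y : 'I_l -> V) :
  zindep x ->
  (forall c d, \sum_(i < k) x i *~ c i + \sum_(i < l) y i *~ d i = 0 ->
     forall i, d i = 0) ->
  zindep (family_cat x y).
Proof.
move=> ix iy c; rewrite big_split_ord /=.
have xE i : family_cat x y (lshift l i) = x i.
  by rewrite /family_cat (unsplitK (inl i)).
have yE i : family_cat x y (rshift k i) = y i.
  by rewrite /family_cat (unsplitK (inr i)).
under eq_bigr do rewrite xE; under [X in _ + X]eq_bigr do rewrite yE.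
move=> xy0.
have d0 i : c (rshift k i) = 0.
  exact: (iy (fun i => c (lshift l i)) (fun i => c (rshift k i))).
have c0 i : c (lshift l i) = 0.
  apply: (ix (fun i => c (lshift l i))); rewrite -[RHS]xy0 [X in _ + X]big1 ?addr0 //.
  by move=> j _; rewrite d0 mulr0z.
by move=> i; rewrite -(splitK i); case: fintype.split.
Qed.

Lemma zindep_map (V W : zmodType) (f : {additive V -> W}) m (x : 'I_m -> V) :
  zindep (f \o x) -> zindep x.
Proof.
move=> ifx c xc0; apply: ifx; rewrite -[RHS](raddf0 f) -xc0 raddf_sum.
by apply: eq_bigr => i _; rewrite raddfMz.
Qed.

Definition family_mx N m (x : 'I_m -> 'cV[int]_N) : 'M[int]_(N, m) :=
  \matrix_(i, j) x j i 0.

Lemma family_mx_mul N m (x : 'I_m -> 'cV[int]_N) (c : 'cV[int]_m) :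
  family_mx x *m c = \sum_(i < m) x i *~ c i 0.
Proof.
apply/matrixP=> i j; rewrite ord1 mxE summxE; apply: eq_bigr => l _.
by rewrite mulrz_mx !mxE mulrC.
Qed.

Lemma zindep_mx N m (x : 'I_m -> 'cV[int]_N) (c : 'cV[int]_m) :
  zindep x -> family_mx x *m c = 0 -> c = 0.
Proof.
rewrite family_mx_mul => ix /ix c0.
by apply/matrixP=> i j; rewrite ord1 mxE c0.
Qed.

(** A Smith normal form with more columns than rows has a zero column, which
    yields a nontrivial relation. *)
Lemma zindep_leq N m (x : 'I_m -> 'cV[int]_N) : zindep x -> (m <= N)%N.
Proof.
move=> ix; rewrite leqNgt; apply/negP=> Nm.
have [U uU [V uV [d _ XE]]] := int_Smith_normal_form (family_mx x).
pose j := Ordinal Nm.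
have : invmx V *m delta_mx j 0 = 0 :> 'cV_m.
  apply: (zindep_mx ix); rewrite XE -!mulmxA mulKVmx //.
  rewrite -colE; apply/matrixP=> i l; rewrite !mxE big1 // => p _.
  by rewrite !mxE [_ == _ :> nat]ltn_eqF ?mulr0 //= ltn_ord.
move/(congr1 (mulmx V)); rewrite mulKVmx // mulmx0 => /matrixP/(_ j 0)/eqP.
by rewrite !mxE !eqxx.
Qed.

(** Write a maximal independent family of [L] as [U D V] in Smith normal form.  Then
    [L] contains the multiples [d_j U_j] of the first [k] columns of [U], with
    [d_j <> 0] by independence, hence the columns themselves by saturation.
    Conversely a vector of [L] with a nonzero later coordinate along [U] would
    enlarge the independent family.  Membership is stated through the
    coordinates along [M] so that it can be tested without choosing
    coefficients. *)
Lemma saturated_basis n k (L : set 'cV[int]_n) :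
  saturated L -> has_rank L k ->
  exists2 M : 'M[int]_n, M \in unitmx &
    forall v, L v <-> forall i : 'I_n, (k <= i)%N -> (invmx M *m v) i 0 = 0.
Proof.
move=> [sL satL] [[x Lx ix] maxL].
have kn := zindep_leq ix.
have [U uU [V uV [d _ XE]]] := int_Smith_normal_form (family_mx x).
exists U => // v; split=> [Lv i ki | low].
  apply/eqP/negPn/negP=> wi0.
  suff ixv : zindep (family_cat x (fun _ : 'I_1 => v)).
    by have := maxL _ _ (family_catP Lx (fun=> Lv)) ixv; rewrite addn1 ltnn.
  apply: zindep_cat => // c e; rewrite big_ord1 => xv0 j; rewrite (ord1 j).
  have : invmx U *m (family_mx x *m (\col_i c i) + v *~ e 0) = 0.
    rewrite family_mx_mul; under eq_bigr do rewrite mxE.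
    by rewrite xv0 mulmx0.
  rewrite mulmxDr XE !mulmxA mulVmx // mul1mx -!mulmxA mulrz_mx -scalemxAr.
  move=> /matrixP/(_ i 0); rewrite [LHS]mxE [X in X + _]mxE [X in _ + X]mxE [RHS]mxE big1 ?add0r.
    by move=> /eqP; rewrite mulf_eq0 (negPf wi0) orbF => /eqP.
  move=> l _; rewrite mxE gtn_eqF ?mul0r //.
  exact: leq_trans (ltn_ord l) ki.
have LU (j : 'I_n) : (j < k)%N -> L (col j U).
  move=> jk; pose j' := Ordinal jk.
  have XV : family_mx x *m (invmx V *m delta_mx j' 0) = d`_j *: col j U.
    rewrite XE -!mulmxA mulKVmx // -colE [col j U]colE scalemxAr; congr (_ *m _).
    apply/matrixP=> i l; rewrite !mxE ord1 eqxx andbT.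
    rewrite -val_eqE /=; case: eqP => [ij|]; rewrite ?mulr0 // mulr1 /=.
    by rewrite ij.
  apply: (satL d`_j).
    apply/eqP=> dj0.
    have /(congr1 (mulmx V)) : invmx V *m delta_mx j' 0 = 0 :> 'cV_k.
      by apply: (zindep_mx ix); rewrite XV dj0 scale0r.
    by rewrite mulKVmx // mulmx0 => /matrixP/(_ j' 0)/eqP; rewrite !mxE !eqxx.
  rewrite mulrz_mx -XV family_mx_mul; apply: (subgroup_sum sL) => i.
  exact: subgroupMz.
have -> : v = \sum_j col j U *~ (invmx U *m v) j 0.
  rewrite -{1}[v](mulKVmx uU); apply/matrixP=> i j; rewrite ord1 mxE summxE.
  by apply: eq_bigr => l _; rewrite mulrz_mx !mxE mulrC.
apply: (subgroup_sum sL) => j; have [jk | kj] := ltnP j k.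
  by apply: (subgroupMz sL); exact: LU.
by rewrite low // mulr0z; exact: sL.1.
Qed.

(** [Z^n] bounds the size of the independent families of any subset. *)
Lemma ex_rank n (L : set 'cV[int]_n) : exists k, has_rank L k.
Proof.
pose P k := `[< exists2 x : 'I_k -> 'cV_n, (forall i, L (x i)) & zindep x >].
have P0 : exists k, P k.
  by exists 0%N; apply/asboolP; exists (fun=> 0) => [[] | c _ []].
have Pn k : P k -> (k <= n)%N by move=> /asboolP[x _ /zindep_leq].
have [k /asboolP Pk maxk] := ex_maxnP P0 Pn.
by exists k; split=> // m x Lx ix; apply: maxk; apply/asboolP; exists x.
Qed.

Lemma colsub_mul m n p (f : 'I_p -> 'I_n) (M : 'M[int]_(m, n)) (c : 'cV[int]_p) :
  colsub f M *m c = \sum_j col (f j) M *~ c j 0.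
Proof.
apply/matrixP=> i j; rewrite ord1 mxE summxE; apply: eq_bigr => l _.
by rewrite mulrz_mx !mxE mulrC.
Qed.

Lemma coord_colsub n p (f : 'I_p -> 'I_n) (M : 'M[int]_n) (c : 'cV[int]_p) j :
  M \in unitmx -> injective f -> (invmx M *m (colsub f M *m c)) (f j) 0 = c j 0.
Proof.
move=> uM injf; rewrite mulmxA mulmx_colsub mulVmx // mxE (bigD1 j) //= big1.
  by rewrite !mxE eqxx mul1r addr0.
by move=> l lj; rewrite !mxE (inj_eq injf) eq_sym (negPf lj) mul0r.
Qed.

Lemma first_idx_inj n r : injective (@first_idx n r).
Proof. by move=> i j /(congr1 val) /= ij; apply: val_inj. Qed.

(** * The Grassmannian as GL_n(Z) / P *)

Section Span.
Variables n r : nat.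
Implicit Types M N : GL n.
Local Notation first_cols M := (colsub (@first_idx n r) (val M)).

Lemma spanP M v : first_cols_span r M v <->
  forall i : 'I_n, (n - r <= i)%N -> (invmx (val M) *m v) i 0 = 0.
Proof.
split=> [[c ->] i ki | low].
  rewrite mulmxA mulmx_colsub mulVmx ?(valP M) // mxE big1 // => l _.
  by rewrite !mxE -val_eqE /= gtn_eqF ?mul0r // (leq_trans (ltn_ord l)).
exists (rowsub (@first_idx n r) (invmx (val M) *m v)).
rewrite -{1}[v](mulKVmx (valP M)); apply/matrixP=> i j; rewrite ord1.
rewrite [in LHS]mxE (bigID (fun l : 'I_n => (l < n - r)%N)) /= [X in _ + X]big1 ?addr0.
  rewrite (big_ord_narrow (leq_subr r n)) /= mxE.
  by apply: eq_bigr => l _; rewrite [in RHS]mxE [rowsub _ _ _ _]mxE.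
by move=> l; rewrite -leqNgt => /low ->; rewrite mulr0.
Qed.

Lemma first_cols_inj M (c : 'cV[int]_(n - r)) : first_cols M *m c = 0 -> c = 0.
Proof.
move=> Mc0; apply/matrixP=> i j; rewrite ord1.
by rewrite -(coord_colsub c i (valP M) (@first_idx_inj n r)) Mc0 mulmx0 !mxE.
Qed.

Lemma span_Gr M : Gr (n - r) n (first_cols_span r M).
Proof.
split.
  split.
    split; first by exists 0; rewrite mulmx0.
    by move=> _ _ [c ->] [d ->]; exists (c - d); rewrite mulmxBr.
  exists [set v | forall i : 'I_n, (i < n - r)%N -> (invmx (val M) *m v) i 0 = 0].
  split=> [|v /spanP hi lo|v].
  - split=> [i _|v w v0 w0 i ik]; first by rewrite mulmx0 mxE.
    by rewrite mulmxBr [LHS]mxE [X in _ + X]mxE v0 // w0 // subrr.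
  - rewrite -[v](mulKVmx (valP M)) [invmx _ *m v](_ : _ = 0) ?mulmx0 //.
    apply/matrixP=> i j; rewrite ord1 [RHS]mxE.
    by have [/lo|/hi] := ltnP i (n - r).
  - pose w := invmx (val M) *m v.
    pose w1 : 'cV[int]_n := \col_i (if (i < n - r)%N then w i 0 else 0).
    exists (val M *m w1), (val M *m (w - w1)); split.
    + by apply/spanP => i ki; rewrite mulKmx ?(valP M) // mxE ltnNge ki.
    + by move=> i ik /=; rewrite mulKmx ?(valP M) // !mxE ik subrr.
    + by rewrite -mulmxDr addrC subrK mulKVmx ?(valP M).
split.
  exists (fun i => col (@first_idx n r i) (val M)) => [i|c].
    exists (delta_mx i 0); rewrite -colE; apply/matrixP=> a b.
    by rewrite !mxE.
  have -> : \sum_(i < n - r) col (first_idx i) (val M) *~ c i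
          = first_cols M *m \col_i c i.
    by rewrite colsub_mul; apply: eq_bigr => i _; rewrite mxE.
  by move=> /first_cols_inj/matrixP c0 i; have := c0 i 0; rewrite !mxE.
move=> m x /choice[c xE] ix; apply: (@zindep_leq _ _ c).
apply: (@zindep_map _ _ (mulmx (first_cols M))).
by rewrite (_ : _ \o c = x) //; apply/funext => i /=.
Qed.

(** The base change [Q = N^-1 M] expresses the columns of [M] along [N]; when the
    spans agree, the first ones have no component along the later columns of
    [N], which is the vanishing of the lower left block. *)
Lemma span_eqP M N : first_cols_span r M = first_cols_span r N ->
  exists Q : parabolic n r, val M = val N *m Q.
Proof.
move=> MN; have low0 : forall i j : 'I_n, (j < n - r <= i)%N -> (invmx (val N) *m val M) i j = 0.
  move=> i j /andP[jk ki].
  have : first_cols_span r M (col j (val M)).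
    exists (delta_mx (Ordinal jk) 0); rewrite -colE; apply/matrixP=> a b.
    by rewrite !mxE; congr (val M _ _); apply: val_inj.
  rewrite MN => /spanP/(_ i ki); rewrite colE mulmxA -colE mxE //.
have uQ : invmx (val N) *m val M \in unitmx.
  by rewrite unitmx_mul unitmx_inv (valP N) (valP M).
by exists (Parabolic uQ low0); rewrite /= mulKVmx ?(valP N).
Qed.

Lemma saturated_span L : saturated L -> has_rank L (n - r) ->
  exists M, L = first_cols_span r M.
Proof.
move=> satL rkL; have [M uM LM] := saturated_basis satL rkL.
exists (exist _ M uM); apply/seteqP.
by split=> v; [move=> /LM Lv; apply/spanP | move=> /spanP Lv; apply/LM].
Qed.

Local Open Scope quotient_scope.

Lemma pi_GLmodP_eqP M N :
  \pi_(GLmodP n r) M = \pi_(GLmodP n r) N <-> exists Q : parabolic n r, val M = val N *m Q.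
Proof.
split=> [/eqP|MN]; first by rewrite piE => /asboolP.
by apply/eqP; rewrite piE; apply/asboolP.
Qed.

Lemma sigma_bij : set_bij [set: GLmodP n r] (Gr (n - r) n) (@sigma n r).
Proof.
split.
- by move=> x _; rewrite -[x]reprK pi_sigma; exact: span_Gr.
- move=> x y _ _; rewrite -[x]reprK -[y]reprK !pi_sigma => /span_eqP MN.
  exact/pi_GLmodP_eqP.
- move=> L [/direct_summand_saturated satL rkL].
  have [M ->] := saturated_span satL rkL.
  by exists (\pi_(GLmodP n r) M); rewrite ?pi_sigma.
Qed.

End Span.

(** * Kernels of surjections from Z^n to A / Tors A *)

Section Kernel.
Local Open Scope quotient_scope.
Variables (A : zmodType) (n r : nat).
Hypothesis rankA : has_rank [set: A] r.

Lemma bar_mulrz_eq0 (x : bar A) (c : int) : c != 0 -> x *~ c = 0 -> x = 0.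
Proof.
case: c => m m0 xm; apply: bar_torsion_free; apply/asboolP.
  by exists m => //; rewrite lt0n.
by exists m.+1 => //; rewrite -[LHS]opprK -[_ *- _]/(x *~ Negz m) xm oppr0.
Qed.

(** A relation modulo torsion becomes a relation in [A] after multiplication by a
    nonzero integer. *)
Lemma zindep_bar m (x : 'I_m -> A) : zindep x -> zindep (\pi_(bar A) \o x).
Proof.
move=> ix c; rewrite (_ : \sum_(i < m) _ = \pi_(bar A) (\sum_(i < m) x i *~ c i)); last first.
  by rewrite raddf_sum; apply: eq_bigr => i _; rewrite raddfMz.
rewrite -(raddf0 \pi_(bar A)) => /bar_eqP; rewrite subr0 => /asboolP[p p0 sum0] i.
have : c i * p = 0.
  apply: (ix (fun i => c i * p)); rewrite -[RHS]sum0 -sumrMnl.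
  by apply: eq_bigr => j _; rewrite mulrzA.
by move=> /eqP; rewrite mulf_eq0 => /orP[/eqP //|]; rewrite -[0]/(Posz 0) eqz_nat (gtn_eqF p0).
Qed.

Variable p : {additive 'cV[int]_n -> bar A}.
Hypothesis p_surj : forall y, exists v, p v = y.

Lemma ker_saturated : saturated [set v | p v = 0].
Proof.
split; first split=> [|v w /= v0 w0]; rewrite /= ?raddf0 //.
  by rewrite raddfB v0 w0 subr0.
by move=> c v c0 /=; rewrite raddfMz; exact: bar_mulrz_eq0.
Qed.

(** The kernel is spanned by [k] columns of some [M], and [k + r = n] by two counts of
    independent families: lifts to [Z^n] of [r] independent elements of [A],
    together with [k] independent elements of the kernel, are independent; and
    the images of the other [n - k] columns of [M] are independent. *)
Lemma ker_span : exists M : GL n, [set v | p v = 0] = first_cols_span r M.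
Proof.
have [k rkk] := ex_rank [set v | p v = 0].
suff kE : k = (n - r)%N by apply: (saturated_span ker_saturated); rewrite -kE.
have [[x kx ix] _] := rkk; have kn := zindep_leq ix.
have [M uM kM] := saturated_basis ker_saturated rkk.
have [[a _ ia] maxA] := rankA.
have krn : (k + r <= n)%N.
  have [y yE] := choice (fun i => p_surj (\pi_(bar A) (a i))).
  apply: (@zindep_leq _ _ (family_cat x y)); apply: zindep_cat => // c d xy0.
  apply: (zindep_bar ia); rewrite -[RHS](raddf0 p) -xy0 raddfD !raddf_sum.
  rewrite [X in X + _]big1 ?add0r; last by move=> i _; rewrite raddfMz kx mul0rz.
  by apply: eq_bigr => i _; rewrite /= -yE raddfMz.
suff : (n - k <= r)%N.
  rewrite leq_subLR => nkr; apply/eqP; rewrite -(eqn_add2r r) subnK.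
    by rewrite eqn_leq krn.
  exact: leq_trans (leq_addl _ _) krn.
pose f (j : 'I_(n - k)) : 'I_n := cast_ord (subnKC kn) (rshift k j).
have injf : injective f.
  by move=> i j /(congr1 val) /= /addnI ij; apply: val_inj.
apply: (maxA _ (fun j => repr (p (col (f j) M)))) => // c yc0.
have /kM low : p (colsub f M *m \col_j c j) = 0.
  transitivity (\pi_(bar A) (\sum_(j < n - k) repr (p (col (f j) M)) *~ c j)).
    2: by rewrite yc0 raddf0.
  rewrite colsub_mul !raddf_sum.
  by apply: eq_bigr => j _; rewrite !raddfMz mxE /= reprK.
move=> j; have := low (f j) (leq_addr _ _).
by rewrite coord_colsub // mxE.
Qed.

End Kernel.

End Lattices.

(** * Splitting off the torsion *)

Section Correspondence.
Local Open Scope ring_scope.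
Local Open Scope quotient_scope.

Definition tval (K : zmodType) (t : Tors K) : K := \val t.

Lemma tval_inj (K : zmodType) : injective (@tval K).
Proof. exact: val_inj. Qed.

Lemma tval_zmod_morphism (K : zmodType) : zmod_morphism (@tval K).
Proof. exact: (raddfB (val : Tors K -> K)). Qed.

HB.instance Definition _ (K : zmodType) :=
  GRing.isZmodMorphism.Build (Tors K) K (@tval K) (@tval_zmod_morphism K).

Lemma tval_torsion (K : zmodType) (t : Tors K) : tval t \in torsion K.
Proof. exact: valP. Qed.

(** A decomposition of [H] as the direct sum of [Z^n] and [Tors H]: a section together
    with the two resulting projections. *)
Record splitting (H : zmodType) (n : nat) := Splitting {
  sec : {additive 'cV[int]_n -> H};
  coord : {additive H -> 'cV[int]_n};
  tor : {additive H -> Tors H};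
  coordK : forall h, sec (coord h) + tval (tor h) = h;
  coord_sec : forall v (t : Tors H), coord (sec v + tval t) = v;
  tor_sec : forall v (t : Tors H), tor (sec v + tval t) = t
}.

Lemma bar_tval (K : zmodType) (t : Tors K) : \pi_(bar K) (tval t) = 0.
Proof.
by rewrite -[RHS](raddf0 \pi_(bar K)); apply/bar_eqP; rewrite subr0; exact: tval_torsion.
Qed.

Lemma map_tval_bar (H A : zmodType) (f : {additive H -> bar A}) (t : Tors H) :
  f (tval t) = 0.
Proof.
apply: bar_torsion_free; have /asboolP[m m0 tm] := tval_torsion t.
by apply/asboolP; exists m => //; rewrite -raddfMn tm raddf0.
Qed.

Lemma bar_eq0_tval (K : zmodType) (x : K) : \pi_(bar K) x = 0 -> exists t : Tors K, tval t = x.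
Proof.
rewrite -[RHS](raddf0 \pi_(bar K)) => /bar_eqP; rewrite subr0 => xT.
by exists (exist _ x xT).
Qed.

(** The section is determined by arbitrary lifts of the images of the standard
    basis, since [Z^n] is free. *)
Lemma splitting_exists (H : zmodType) n (iH : {additive 'cV[int]_n -> bar H}) :
  bijective iH ->
  exists S : splitting H n, forall v, \pi_(bar H) (sec S v) = iH v.
Proof.
move=> [jH iHK jHK].
pose s (v : 'cV[int]_n) : H := \sum_j repr (iH (col j 1%:M)) *~ v j 0.
have sB : zmod_morphism s.
  move=> v w; rewrite /s -sumrB; apply: eq_bigr => j _.
  by rewrite [(v - w) j 0]mxE [(- w) j 0]mxE mulrzBr.
have sE v : \pi_(bar H) (s v) = iH v.
  have {2}-> : v = colsub id 1%:M *m v.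
    rewrite [colsub _ _](_ : _ = 1%:M) ?mul1mx //.
    by apply/matrixP => i j; rewrite !mxE.
  rewrite colsub_mul !raddf_sum; apply: eq_bigr => j _.
  by rewrite !raddfMz /= reprK.
pose s' : {additive 'cV[int]_n -> H} :=
  HB.pack s (GRing.isZmodMorphism.Build _ _ s sB).
pose j' : {additive bar H -> 'cV[int]_n} :=
  HB.pack jH (GRing.isZmodMorphism.Build _ _ jH (can2_zmod_morphism iHK jHK)).
pose co : {additive H -> 'cV[int]_n} := j' \o \pi_(bar H).
have tP h : h - s' (co h) \in torsion H by apply/bar_eqP; rewrite sE jHK.
pose t h : Tors H := exist (fun x => x \in torsion H) _ (tP h).
have tB : zmod_morphism t.
  have tvalt x : tval (t x) = x - s' (co x) by [].
  move=> h k; apply: tval_inj; rewrite [RHS]raddfB !tvalt.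
  by rewrite (raddfB co) (raddfB s') !opprD !opprK addrACA.
pose t' : {additive H -> Tors H} := HB.pack t (GRing.isZmodMorphism.Build _ _ t tB).
have c1 h : s' (co h) + tval (t' h) = h by rewrite addrC subrK.
have c2 v (x : Tors H) : co (s' v + tval x) = v.
  have coE y : co y = jH (\pi_(bar H) y) by [].
  by rewrite coE raddfD /= bar_tval addr0 sE iHK.
have c3 v (x : Tors H) : t' (s' v + tval x) = x.
  by apply: tval_inj; transitivity (s' v + tval x - s' (co (s' v + tval x)));
    rewrite // c2 addrC addKr.
by exists (Splitting c1 c2 c3).
Qed.

(** * Epimorphisms and pairs of a matrix and an epimorphism *)

Variables (H A : zmodType) (n r : nat) (iH : {additive 'cV[int]_n -> bar H}).
Variable S : splitting H n.
Hypothesis SE : forall v, \pi_(bar H) (sec S v) = iH v.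
Hypothesis rankA : has_rank [set: A] r.
Local Notation first_cols M := (colsub (@first_idx n r) (val M)).
Local Notation epiT := (epi ('cV[int]_(n - r) * Tors H)%type (Tors A)).

Lemma ker_inducedE (mu : epi H (bar A)) v : ker_induced iH mu v <-> mu (sec S v) = 0.
Proof. by rewrite /ker_induced /= -SE inducedE. Qed.

Lemma sec_surj (mu : epi H (bar A)) h : mu h = mu (sec S (coord S h)).
Proof. by rewrite -{1}[h](coordK S) raddfD map_tval_bar addr0. Qed.

Lemma ker_induced_span (mu : epi H (bar A)) :
  exists M : GL n, ker_induced iH mu = first_cols_span r M.
Proof.
have p_surj y : exists v, (mu \o sec S) v = y.
  by have [h <-] := epi_surj mu y; exists (coord S h); rewrite [RHS]sec_surj.
have [M ME] := ker_span rankA p_surj; exists M; rewrite -ME.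
by apply/seteqP; split=> v /ker_inducedE.
Qed.

(** A map realising the quotient of [Z^n] by the span of the first columns of [M]
    as [bar A], lifted to [A].  One epimorphism [f0] gives such a map for some
    matrix [M0]; the base change [M0 M^-1] carries it over to [M]. *)
Lemma span_complement (f0 : epi H A) (M : GL n) :
  exists w : {additive 'cV[int]_n -> A},
    (forall y, exists v, \pi_(bar A) (w v) = y) /\
    forall v, \pi_(bar A) (w v) = 0 <-> first_cols_span r M v.
Proof.
have [M0 M0E] := ker_induced_span (proj_epi f0).
pose B := val M0 *m invmx (val M).
exists (f0 \o sec S \o mulmx B); split=> [y | v].
  have [h <-] := epi_surj (proj_epi f0) y; exists (val M *m invmx (val M0) *m coord S h).
  rewrite [RHS]sec_surj /= /B !mulmxA mulmxKV ?(valP M) // mulmxV ?(valP M0) //.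
  by rewrite mul1mx.
have -> : \pi_(bar A) (f0 (sec S (B *m v))) = 0 <-> first_cols_span r M0 (B *m v).
  by rewrite -M0E; split=> [/(ker_inducedE (proj_epi f0)) | /ker_inducedE].
rewrite !spanP; split=> lo i /lo; rewrite /B -mulmxA mulKmx ?(valP M0) //.
Qed.

(** An epimorphism to [bar A] kills [Tors H], so its kernel is determined by
    the kernel that it induces on [Z^n]; every primitive subgroup of the right
    rank arises, as the kernel of a map from [span_complement]. *)
Lemma kappa_bij (f0 : epi H A) :
  set_bij [set: Gamma H (bar A)] (Gr (n - r) n) (kappa (A := A) iH).
Proof.
split.
- move=> x _; rewrite -[x]reprK pi_kappa.
  by have [M ->] := ker_induced_span (repr x); exact: span_Gr.
- move=> x y _ _; rewrite -[x]reprK -[y]reprK !pi_kappa => xy.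
  apply/Gamma_kerP => h; rewrite sec_surj [X in _ <-> X = 0]sec_surj.
  by rewrite -!ker_inducedE xy.
- move=> L [/direct_summand_saturated satL rkL].
  have [M ->] := saturated_span satL rkL.
  have [w [w_surj kw]] := span_complement f0 M.
  pose m : {additive H -> bar A} := \pi_(bar A) \o (w \o coord S).
  have m_surj y : exists h, m h = y.
    have [v <-] := w_surj y; exists (sec S v + tval (0 : Tors H)).
    by rewrite /m /= coord_sec.
  exists (\pi_(Gamma H (bar A)) (Epi m_surj)) => //; rewrite pi_kappa.
  apply/seteqP; split=> v.
    move=> /ker_inducedE; rewrite /= -[sec S v]addr0 -(raddf0 (@tval H)) coord_sec.
    by move=> /kw.
  move=> /kw wv0; apply/ker_inducedE.
  by rewrite /= -[sec S v]addr0 -(raddf0 (@tval H)) coord_sec.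
Qed.

(** The data [(M, g)] determine [ker f]: it is the kernel of [g], inside the sum of
    the span of the first columns of [M] and [Tors H]. *)
Definition matches (f : epi H A) (M : GL n) (g : epiT) : Prop :=
  ker_induced iH (proj_epi f) = first_cols_span r M /\
  forall c t, f (sec S (first_cols M *m c) + tval t) = tval (g (c, t)).

(** Add to [g], extended by zero along the last columns of [M], a map [w] as in
    [span_complement], made to vanish on the first columns by composing it with
    the projection along them.  The sum is onto: [w] reaches every class of
    [bar A], and [g] corrects the remaining torsion. *)
Lemma matches_exists_epi (f0 : epi H A) M g : exists f, matches f M g.
Proof.
have [w [w_surj kw]] := span_complement f0 M.
(* [R] reads the coordinates along the first columns of [M], and [e] is the
   projection onto their span along the other columns. *)
pose R : 'M[int]_(n - r, n) := rowsub (@first_idx n r) (invmx (val M)).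
have RC (c : 'cV[int]_(n - r)) : R *m (first_cols M *m c) = c.
  apply/matrixP=> i j; rewrite ord1 mul_rowsub_mx mxE.
  by rewrite coord_colsub ?(valP M) //; exact: first_idx_inj.
pose e (v : 'cV[int]_n) := first_cols M *m (R *m v).
have we v : \pi_(bar A) (w (v - e v)) = \pi_(bar A) (w v).
  rewrite !raddfB /= (_ : \pi_(bar A) (w (e v)) = 0) ?subr0 //.
  by apply/kw; exists (R *m v).
pose F h := w (coord S h - e (coord S h)) + tval (g (R *m coord S h, tor S h)).
have eB : zmod_morphism (fun v => v - e v).
  by move=> v v'; rewrite /e !mulmxBr !opprD !opprK addrACA.
have FB : zmod_morphism F.
  move=> h k; rewrite /F !(raddfB (coord S)) (raddfB (tor S)) eB raddfB mulmxBr.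
  rewrite (_ : (_ - _, _ - _) = (R *m coord S h, tor S h) - (R *m coord S k, tor S k)) //.
  by rewrite (raddfB g) (raddfB (@tval A)) addrACA opprD.
pose F' : {additive H -> A} := HB.pack F (GRing.isZmodMorphism.Build _ _ F FB).
have Fpi h : \pi_(bar A) (F h) = \pi_(bar A) (w (coord S h)).
  by rewrite /F raddfD /= bar_tval addr0 we.
have FE c u t : R *m u = 0 -> F (sec S (first_cols M *m c + u) + tval t) = w u + tval (g (c, t)).
  move=> Ru; rewrite /F coord_sec tor_sec /e mulmxDr RC Ru addr0.
  by rewrite [_ + u]addrC addrK.
have F_surj y : exists h, F' h = y.
  have [v wv] := w_surj (\pi_(bar A) y).
  have [t0 t0E] : exists t0 : Tors A, tval t0 = y - w (v - e v).
    by apply: bar_eq0_tval; rewrite (raddfB \pi_(bar A)) /= we wv subrr.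
  have [[c t] ct] := epi_surj g t0.
  exists (sec S (first_cols M *m c + (v - e v)) + tval t).
  by rewrite [LHS]FE ?mulmxBr ?RC ?subrr // ct t0E addrC subrK.
exists (Epi F_surj); split=> [|c t].
  apply/seteqP; split=> v.
    move=> /ker_inducedE; rewrite /= -[sec S v]addr0 -(raddf0 (@tval H)) Fpi coord_sec.
    by move=> /kw.
  move=> /kw wv0; apply/ker_inducedE.
  by rewrite /= -[sec S v]addr0 -(raddf0 (@tval H)) Fpi coord_sec.
by have := @FE c 0 t; rewrite mulmx0 addr0 raddf0 add0r; exact.
Qed.

(** Restricting [f] to the preimage of [Tors A] keeps it onto [Tors A]. *)
Lemma matches_exists_pair f : exists M g, matches f M g.
Proof.
have [M ME] := ker_induced_span (proj_epi f).
have fT (x : 'cV[int]_(n - r) * Tors H) :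
    exists t : Tors A, tval t = f (sec S (first_cols M *m x.1) + tval x.2).
  apply: bar_eq0_tval; rewrite -[LHS]/(proj_epi f _) raddfD map_tval_bar addr0.
  by apply/ker_inducedE; rewrite ME; exists x.1.
have [g gE] := choice fT.
have gB : zmod_morphism g.
  move=> x y; apply: tval_inj; rewrite [RHS]raddfB /= !gE -(raddfB f) /=.
  by rewrite mulmxBr (raddfB (sec S)) (raddfB (@tval H)) opprD addrACA.
pose g' : {additive 'cV[int]_(n - r) * Tors H -> Tors A} :=
  HB.pack g (GRing.isZmodMorphism.Build _ _ g gB).
have g_surj y : exists x, g' x = y.
  have [h hy] := epi_surj f (tval y).
  have : first_cols_span r M (coord S h).
    by rewrite -ME; apply/ker_inducedE; rewrite -sec_surj /= hy bar_tval.
  move=> [c cE]; exists (c, tor S h); apply: tval_inj.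
  by rewrite [LHS]gE /= -cE coordK.
by exists M, (Epi g_surj); split=> // c t; rewrite /= gE.
Qed.

(** Both sides say that [f] and [f'] have the same kernel.  From left to right, equal
    classes have equal images under [q], so the spans agree and [M = M' Q]; then
    [Q] acting on [g] gives the restriction of [f] in the coordinates of [M']
    ([actE]), to be compared with [g'].  From right to left, both kernels lie in
    the common span plus torsion, where they are those of the restrictions. *)
Lemma matches_eqP f f' M M' g g' : matches f M g -> matches f' M' g' ->
  \pi_(Gamma H A) f = \pi_(Gamma H A) f' <->
  \pi_(twisted_product H A n r) (M, \pi_(GammaT H A n r) g) =
  \pi_(twisted_product H A n r) (M', \pi_(GammaT H A n r) g').
Proof.
move=> [kf fg] [kf' fg'].
have twistP : \pi_(twisted_product H A n r) (M, \pi_(GammaT H A n r) g) =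
    \pi_(twisted_product H A n r) (M', \pi_(GammaT H A n r) g') <->
  exists2 Q : parabolic n r, val M = val M' *m Q &
    forall x, g' x = 0 <-> act_epi Q g x = 0.
  split=> [/eqP|[Q MQ gQ]].
    rewrite piE => /asboolP[Q MQ]; rewrite /= -pi_act => /Gamma_kerP gQ.
    by exists Q.
  apply/eqP; rewrite piE; apply/asboolP; exists Q => //=.
  by rewrite -pi_act; apply/Gamma_kerP.
have actE (Q : parabolic n r) c t : val M = val M' *m Q ->
    tval (act_epi Q g (c, t)) = f (sec S (first_cols M' *m c) + tval t).
  move=> MQ; rewrite /= /block_act /= -fg MQ colsub_par.
  by rewrite -mulmxA mulKVmx ?Q1_unit.
have val0 (x : Tors A) : x = 0 <-> tval x = 0.
  by split=> [-> | x0]; [rewrite raddf0 | apply: tval_inj; rewrite x0 raddf0].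
rewrite twistP; split=> [ff' | [Q MQ gQ] ].
  have MM' : first_cols_span r M = first_cols_span r M'.
    by rewrite -kf -kf' -!pi_kappa !pi_q ff'.
  have [Q MQ] := span_eqP MM'; exists Q => // -[c t].
  rewrite !val0 actE // -fg'; apply: iff_sym.
  by move/Gamma_kerP: ff'; apply.
have MM' : first_cols_span r M = first_cols_span r M'.
  by rewrite -!pi_sigma; congr sigma; apply/pi_GLmodP_eqP; exists Q.
apply/Gamma_kerP => h.
have hM (f1 : epi H A) : ker_induced iH (proj_epi f1) = first_cols_span r M' ->
    f1 h = 0 -> exists c, coord S h = first_cols M' *m c.
  move=> kE f1h; suff : first_cols_span r M' (coord S h) by [].
  by rewrite -kE; apply/ker_inducedE; rewrite -sec_surj /= f1h raddf0.
have key c : coord S h = first_cols M' *m c -> f h = 0 <-> f' h = 0.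
  move=> hc; rewrite -{1 2}[h](coordK S) hc -(actE Q) // fg' -!val0.
  exact: iff_sym.
split=> fh0; first by have [|c /key[]] := hM f _ fh0; [rewrite kf | auto].
by have [|c /key[]] := hM f' _ fh0; [| auto].
Qed.

End Correspondence.

Theorem theorem3p2 (H A : zmodType) (n r : nat)
  (fgH : fin_gen H) (fgA : fin_gen A) (epiHA : inhabited (epi H A))
  (rankH : has_rank [set: H] n) (rankA : has_rank [set: A] r)
  (iH : {additive 'cV[int]_n -> bar H}) (iH_bij : bijective iH) :
  [/\ set_bij [set: Gamma H (bar A)] (Gr (n - r) n) (kappa (A := A) iH),
      set_bij [set: GLmodP n r] (Gr (n - r) n) (@sigma n r)
    & exists Phi : Gamma H A -> twisted_product H A n r,
        bijective Phi /\
        forall x : Gamma H A, kappa iH (q x) = sigma (canonical_proj (Phi x))].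
Proof.
case: epiHA => f0; have [S SE] := splitting_exists iH_bij.
split; [exact: (kappa_bij SE rankA f0) | exact: sigma_bij |].
have /choice[P PE] : forall f : epi H A,
    exists P : GL n * epi ('cV[int]_(n - r) * Tors H)%type (Tors A),
      matches iH S f P.1 P.2.
  by move=> f; have [M [g fMg]] := matches_exists_pair SE rankA f; exists (M, g).
pose pair (f : epi H A) : twisted_product H A n r :=
  (\pi_(twisted_product H A n r) ((P f).1, \pi_(GammaT H A n r) (P f).2))%qT.
exists (fun x => pair (repr x)); split=> [|x].
  rewrite -setTT_bijective; split=> // [x y _ _|y _].
    by move=> /(matches_eqP SE (PE _) (PE _)); rewrite !reprK.
  have [f fy] := matches_exists_epi SE rankA f0 (repr y).1 (repr (repr y).2).
  exists (\pi_(Gamma H A) f)%qT => //; rewrite -[RHS]reprK.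
  transitivity (\pi_(twisted_product H A n r)
    ((repr y).1, \pi_(GammaT H A n r) (repr (repr y).2)))%qT.
    by apply/(matches_eqP SE (PE _) fy); rewrite reprK.
  by rewrite [X in (_, X)]reprK; case: (repr y).
rewrite -{1}[x]reprK -pi_q pi_kappa (PE (repr x)).1.
by rewrite -pi_canonical_proj pi_sigma.
Qed.
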